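(* Let $G$ be a finite simple undirected graph with vertices $v_1,\dots,v_n$, with $m$ edges, and with every vertex of degree at least $2$. Let $d(v_i)$ be the degree of $v_i$, and let $\chi(u,0)=\det(\mathbf{T}+u\mathbf{J})=d_0u^{2m}+d_1u^{2m-1}+\cdots+d_{2m}$ be the reduced Bartholdi zeta function of $G$. Then $$d_3=(-1)^m\cdot 2\sum_{\substack{1\le i\le n\\ d(v_i)\ge3}}\binom{d(v_i)}{3}.$$
   Context: Symmetric digraph: $\mathcal{D}(G)$ has vertex set $V(G)$ and arc set $\mathcal{E}(G)=\{(x,y),(y,x): xy\in E(G)\}$. For an arc $a=(x,y)$, $o(a)=x$, $t(a)=y$, $a^{-1}=(y,x)$. Label the $2m$ arcs $a_1,\dots,a_m,a_{m+1}=a_1^{-1},\dots,a_{2m}=a_m^{-1}$ (for an arbitrary orientation of the edges). The $2m\times2m$ matrices are: $\mathbf{T}_{ij}=1$ if $t(a_i)=o(a_j)$ and $a_j\ne a_i^{-1}$, and $0$ otherwise; $\mathbf{J}_{ij}=1$ if $a_j=a_i^{-1}$, and $0$ otherwise. *)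

(* Defs.v *)
From HB Require Import structures.
From mathcomp Require Import all_boot all_order all_algebra.

Set Implicit Arguments.
Unset Strict Implicit.
Unset Printing Implicit Defensive.

Import GRing.Theory.
Local Open Scope ring_scope.

(* A finite simple graph is given by its adjacency relation [e], assumed
   symmetric and irreflexive in the theorem. *)
Definition degree (V : finType) (e : rel V) (v : V) : nat :=
  #|[set w | e v w]|.

Definition edges (V : finType) (e : rel V) : {set {set V}} :=
  [set [set p.1; p.2] | p : V * V & e p.1 p.2].

Definition arcs (V : finType) (e : rel V) : {set V * V} :=
  [set p : V * V | e p.1 p.2].

Definition origin (V : finType) (p : V * V) : V := p.1.
Definition terminus (V : finType) (p : V * V) : V := p.2.
Definition arc_inv (V : finType) (p : V * V) : V * V := (p.2, p.1).

(* Indices are 0-based: [lshift m i] is the position i and [rshift m i] the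
   position m + i, so the first m arcs form an orientation of the edges. *)
Definition arc_labelling (V : finType) (e : rel V) (m : nat)
    (a : 'I_(m + m) -> V * V) : Prop :=
  [/\ injective a,
      [set a i | i : 'I_(m + m)] = arcs e
    & forall i : 'I_m, a (rshift m i) = arc_inv (a (lshift m i))].

Definition matT (V : finType) (m : nat) (a : 'I_(m + m) -> V * V) :
    'M[int]_(m + m) :=
  \matrix_(i, j) (if (terminus (a i) == origin (a j))
                     && (a j != arc_inv (a i)) then 1 else 0).

Definition matJ (V : finType) (m : nat) (a : 'I_(m + m) -> V * V) :
    'M[int]_(m + m) :=
  \matrix_(i, j) (if a j == arc_inv (a i) then 1 else 0).

(* The indeterminate 'X plays the role of u. *)
Definition reduced_bartholdi (V : finType) (m : nat)
    (a : 'I_(m + m) -> V * V) : {poly int} :=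
  \det (map_mx polyC (matT a) + 'X *: map_mx polyC (matJ a)).

(* d_k is the coefficient of u^(2m - k). The guard makes d_k = 0 when k > 2m,
   where truncated subtraction would otherwise return the constant term; for
   k = 3 and minimum degree 2 this only concerns the graph without vertices. *)
Definition bartholdi_coef (V : finType) (m : nat)
    (a : 'I_(m + m) -> V * V) (k : nat) : int :=
  if (k <= 2 * m)%N then (reduced_bartholdi a)`_(2 * m - k)%N else 0.

(* Main.v *)
Require Import Defs.
From HB Require Import structures.
From mathcomp Require Import all_boot all_order all_fingroup all_algebra.

Set Implicit Arguments.
Unset Strict Implicit.
Unset Printing Implicit Defensive.

Import GRing.Theory.
Local Open Scope ring_scope.

(** Multiplying by J permutes the columns of T so that arcs are compared by
    their termini: T + uJ = (A + uI) J, where A_ij = 1 exactly when a_i and a_j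
    are distinct arcs with the same terminus ([reduced_bartholdiE]). Since the
    labelling puts the inverse of arc i at distance m, J is the block matrix
    with rows (0 I) and (I 0), so det J = (-1)^m ([det_swap_mx]), and d_3 is
    (-1)^m times the coefficient of u^(2m-3) in det (A + uI).

    The diagonal of A is zero, so in the Leibniz expansion of det (A + uI) each
    fixed point of a permutation contributes exactly a factor u. The coefficient
    of u^(2m-3) therefore comes from the permutations that move exactly three
    indices ([det_add_scalarX]). These are the two 3-cycles on each set of three
    indices ([sum_moved3]); they are even, and each contributes 1 if the three
    arcs share their terminus and 0 otherwise. So the coefficient is twice the
    number of triples of arcs with a common terminus ([coef3_det_fibre_adj]),
    and d(v) arcs end at v ([card_terminus_fibre]). *)

(** * Coefficients of a determinant with the variable on the diagonal *)

Definition moved (T : finType) (s : {perm T}) : {set T} := [set i | s i != i].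

Lemma moved_stable (T : finType) (s : {perm T}) (x : T) :
  (s x \in moved s) = (x \in moved s).
Proof. by rewrite !inE inj_eq //; apply: perm_inj. Qed.

(** In the Leibniz expansion the term of s is a constant times the power of 'X
    given by the number of fixed points of s, because the diagonal entries are
    exactly 'X. *)
Lemma det_add_scalarX (R : comNzRingType) (n : nat) (A : 'M[R]_n)
    (A0 : forall i, A i i = 0) (k : nat) (le_kn : (k <= n)%N) :
  (\det (map_mx polyC A + 'X%:M))`_(n - k)
    = \sum_(s : 'S_n | #|moved s| == k)
        (-1) ^+ s * \prod_(i in moved s) A i (s i).
Proof.
rewrite /determinant coef_sum [RHS]big_mkcond; apply: eq_bigr => s _ /=.
have -> : \prod_i (map_mx polyC A + 'X%:M) i (s i)
    = (\prod_(i in moved s) A i (s i))%:P * 'X^(n - #|moved s|).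
  rewrite (bigID (mem (moved s))) /= rmorph_prod; congr (_ * _).
    apply: eq_bigr => i; rewrite inE !mxE eq_sym => /negPf ->.
    by rewrite mulr0n addr0.
  rewrite (eq_bigr (fun=> 'X)) => [|i]; last first.
    by rewrite inE negbK !mxE => /eqP ->; rewrite A0 eqxx add0r.
  have -> : (n - #|moved s|)%N = #|~: moved s|.
    by rewrite [in RHS]cardsCs setCK card_ord.
  by rewrite -prodr_const; apply: eq_bigl => i; rewrite !inE.
have le_sn : (#|moved s| <= n)%N.
  by have := max_card (mem (moved s)); rewrite card_ord.
rewrite -signr_odd -[in RHS]signr_odd.
rewrite -(rmorphN1 (@polyC R)) -rmorphXn /= mulrA -rmorphM /= coefCM coefXn.
have -> : (n - k == n - #|moved s|)%N = (#|moved s| == k).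
  by rewrite -(eqn_add2r k) subnK // -(eqn_add2r #|moved s|) addnAC subnK //
     eqn_add2l.
by case: ifP; rewrite ?mulr1 ?mulr0.
Qed.

(** * Permutations moving three points *)

Section ThreeCycles.

Variables (T : finType) (x y z : T).
Hypotheses (neq_xy : x != y) (neq_xz : x != z) (neq_yz : y != z).

(** Products of permutations act from left to right, so this is the cycle
    x -> y -> z -> x. *)
Definition cycle3 : {perm T} := (tperm x y * tperm x z)%g.

Lemma cycle3E : [/\ cycle3 x = y, cycle3 y = z & cycle3 z = x].
Proof.
rewrite /cycle3 !permM tpermL tpermR tpermL; split=> //.
  by rewrite tpermD // eq_sym.
by rewrite (@tpermD _ x y z) // tpermR.
Qed.

Lemma moved_cycle3 : moved cycle3 = [set x; y; z].
Proof.
have [cx cy cz] := cycle3E.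
apply/setP=> i; rewrite !inE.
case: (eqVneq i x) => [->|nx]; first by rewrite cx eq_sym neq_xy.
case: (eqVneq i y) => [->|ny]; first by rewrite cy eq_sym neq_yz.
case: (eqVneq i z) => [->|nz]; first by rewrite cz neq_xz.
by rewrite /cycle3 permM !tpermD ?eqxx // eq_sym.
Qed.

Lemma odd_cycle3 : odd_perm cycle3 = false.
Proof. by rewrite /cycle3 odd_permM !odd_tperm neq_xy neq_xz. Qed.

(** A permutation that moves exactly three points is determined by one image:
    after x -> y, sending z to y breaks injectivity, and then sending y back to
    x does too. *)
Lemma eq_cycle3 (s : {perm T}) (ms : moved s = [set x; y; z]) (sx : s x = y) :
  s = cycle3.
Proof.
have [cx cy cz] := cycle3E.
have inj := @perm_inj _ s.
have sz : s z = x.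
  have in_m : z \in moved s by rewrite ms !inE eqxx !orbT.
  have := in_m; rewrite -moved_stable ms !inE.
  move: in_m; rewrite inE => /negPf->; rewrite ?orbF => /orP[] /eqP // szy.
  by case/eqP: neq_xz; apply: inj; rewrite sx szy.
have sy : s y = z.
  have in_m : y \in moved s by rewrite ms !inE eqxx !orbT.
  have := in_m; rewrite -moved_stable ms !inE.
  move: in_m; rewrite inE => /negPf->; rewrite ?orbF => /orP[] /eqP // syx.
  by case/eqP: neq_yz; apply: inj; rewrite sz syx.
apply/permP=> i.
case: (boolP (i \in moved s)) => [|fix_s].
  by rewrite ms !inE => /orP[/orP[]|] /eqP ->; rewrite ?sx ?sy ?sz.
have fix_c : i \notin moved cycle3 by rewrite moved_cycle3 -ms.
by move: fix_s fix_c; rewrite !inE !negbK => /eqP -> /eqP ->.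
Qed.

End ThreeCycles.

(** The two terms are those of the two cyclic orders of x, y, z; both have sign
    +1 because a 3-cycle is even. *)
Lemma sum_moved3 (R : comNzRingType) (T : finType) (F : T -> T -> R)
    (x y z : T) (neq_xy : x != y) (neq_xz : x != z) (neq_yz : y != z) :
  \sum_(s : {perm T} | moved s == [set x; y; z])
      (-1) ^+ s * \prod_(i in moved s) F i (s i)
    = F x y * F y z * F z x + F x z * F z y * F y x.
Proof.
have term (x' y' z' : T) : x' != y' -> x' != z' -> y' != z' ->
    (-1) ^+ cycle3 x' y' z' * \prod_(i in moved (cycle3 x' y' z'))
       F i (cycle3 x' y' z' i) = F x' y' * F y' z' * F z' x' :> R.
  move=> nxy nxz nyz; have [cx cy cz] := cycle3E nxy nxz nyz.
  rewrite odd_cycle3 // mul1r moved_cycle3 // setUC.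
  rewrite big_setU1 /= ?inE; last by rewrite negb_or ![z' == _]eq_sym nxz nyz.
  by rewrite big_setU1 ?inE // big_set1 cx cy cz mulrC.
have neq_zy : z != y by rewrite eq_sym.
have set_xzy : [set x; z; y] = [set x; y; z] by rewrite setUAC.
have [cx _ _] := cycle3E neq_xy neq_xz neq_yz.
have [dx _ _] := cycle3E neq_xz neq_xy neq_zy.
have neq_c : cycle3 x z y != cycle3 x y z.
  by apply/eqP=> /(congr1 (fun s : {perm T} => s x)); rewrite cx dx => /eqP;
     rewrite (negPf neq_zy).
rewrite (bigD1 (cycle3 x y z)) /=; last by rewrite moved_cycle3.
rewrite (bigD1 (cycle3 x z y)) /=; last first.
  by rewrite moved_cycle3 // set_xzy eqxx.
rewrite !term // big_pred0 ?addr0 // => s.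
apply/negP=> /andP[/andP[/eqP ms /negP ns1] /negP ns2].
have in_m : x \in moved s by rewrite ms !inE eqxx.
have := in_m; rewrite -moved_stable ms !inE.
move: in_m; rewrite inE => /negPf-> /= /orP[] /eqP sx.
  by apply: ns1; apply/eqP; apply: eq_cycle3.
by apply: ns2; apply/eqP; apply: eq_cycle3; rewrite ?set_xzy.
Qed.

(** * Principal minors of order three of a disjoint union of complete graphs *)

(** The adjacency matrix of the disjoint union of the complete graphs on the
    fibres of f. *)
Definition fibre_adj (R : nzRingType) (n : nat) (V : eqType)
    (f : 'I_n -> V) : 'M[R]_n :=
  \matrix_(i, j) ((i != j) && (f i == f j))%:R.

(** At most one fibre contains the nonempty set S, so the sum over v says that
    the value is 2 when f is constant on S and 0 otherwise. Stating it as a sum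
    over v prepares the exchange of summations in the count by fibres. *)
Lemma sum_moved3_fibre (R : comNzRingType) (n : nat) (V : finType)
    (f : 'I_n -> V) (S : {set 'I_n}) (S3 : #|S| = 3) :
  \sum_(s : 'S_n | moved s == S)
      (-1) ^+ s * \prod_(i in moved s) fibre_adj R f i (s i)
    = \sum_(v : V) 2 * (S \subset [set i | f i == v])%:R.
Proof.
have [x xS] : exists x, x \in S by apply/card_gt0P; rewrite S3.
have /cards2P[y [z [nyz Dyz]]] : #|S :\ x| == 2.
  by move: S3; rewrite (cardsD1 x) xS add1n => -[->].
have nxy : x != y by have := set21 y z; rewrite -Dyz !inE eq_sym => /andP[].
have nxz : x != z by have := set22 y z; rewrite -Dyz !inE eq_sym => /andP[].
have DS : S = [set x; y; z] by rewrite -(setD1K xS) Dyz setUA.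
rewrite DS (sum_moved3 (fibre_adj R f)) // !mxE.
rewrite [z == x]eq_sym [z == y]eq_sym [y == x]eq_sym nxy nxz nyz /=.
rewrite [f z == f x]eq_sym [f z == f y]eq_sym [f y == f x]eq_sym.
rewrite (bigD1 (f x)) //= big1 => [|v nv]; last first.
  rewrite (_ : _ \subset _ = false) ?mulr0 //.
  apply/negP=> /subsetP/(_ x); rewrite !inE eqxx => /(_ isT) /eqP fx.
  by rewrite fx eqxx in nv.
rewrite !subUset !sub1set !inE eqxx /= addr0 [f y == f x]eq_sym [f z == _]eq_sym.
case: (eqVneq (f x) (f y)) => [->|_] /=; last by rewrite !(mul0r, mulr0, addr0).
by case: (f y == f z); rewrite /= !(mul0r, mulr0, mulr1, addr0).
Qed.

(** Grouping the permutations by the three points they move reduces the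
    coefficient to counting three-element subsets of the fibres of f. *)
Lemma coef3_det_fibre_adj (R : comNzRingType) (n : nat) (V : finType)
    (f : 'I_n -> V) (le_3n : (3 <= n)%N) :
  (\det (map_mx polyC (fibre_adj R f) + 'X%:M))`_(n - 3)
    = 2 * \sum_(v : V) ('C(#|[set i | f i == v]|, 3))%:R.
Proof.
rewrite det_add_scalarX => [|i|//]; last by rewrite mxE eqxx.
rewrite (partition_big (@moved _) (fun S => #|S| == 3)) //=.
transitivity (\sum_(S : {set 'I_n} | #|S| == 3)
    \sum_(v : V) 2 * (S \subset [set i | f i == v])%:R : R).
  apply: eq_bigr => S /eqP S3; rewrite -sum_moved3_fibre //.
  apply: eq_bigl => s; case: (eqVneq (moved s) S) => [->|]; last by rewrite andbF.
  by rewrite S3.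
rewrite exchange_big mulr_sumr; apply: eq_bigr => v _ /=.
rewrite -mulr_sumr -cards_draws -sum1_card natr_sum; congr (_ * _).
rewrite big_mkcond [RHS]big_mkcond; apply: eq_bigr => S _.
by rewrite !inE andbC; case: (#|S| == 3); case: (S \subset _).
Qed.

(** * The matrices of an arc labelling *)

(** Block row and column operations turn the matrix into a lower triangular one
    with diagonal blocks I and -I. *)
Lemma det_swap_mx (R : comNzRingType) (m : nat) :
  \det (block_mx 0 1%:M 1%:M 0 : 'M[R]_(m + m)) = (-1) ^+ m.
Proof.
set J := block_mx _ _ _ _.
have E : block_mx 1%:M 1%:M 0 1%:M *m J *m block_mx 1%:M (- 1%:M) 0 1%:M
         = block_mx 1%:M 0 1%:M (- 1%:M) :> 'M[R]_(m + m).
  rewrite !mulmx_block; congr block_mx;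
    by rewrite ?(mul0mx, mulmx0, mul1mx, mulmx1, mulmxN, add0r, addr0, addNr).
have := congr1 determinant E.
rewrite !det_mulmx !det_ublock det_lblock !det1 !mul1r !mulr1 => ->.
by rewrite -scaleN1r detZ det1 mulr1.
Qed.

Section Labelling.

Variables (V : finType) (e : rel V) (m : nat) (a : 'I_(m + m) -> V * V).
Hypothesis a_lab : arc_labelling e a.

Definition swap_half (i : 'I_(m + m)) : 'I_(m + m) :=
  match split i with inl k => rshift m k | inr k => lshift m k end.

Lemma swap_half_lshift k : swap_half (lshift m k) = rshift m k.
Proof. by rewrite /swap_half (unsplitK (inl k)). Qed.

Lemma swap_half_rshift k : swap_half (rshift m k) = lshift m k.
Proof. by rewrite /swap_half (unsplitK (inr k)). Qed.

Lemma swap_halfK : involutive swap_half.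
Proof.
move=> i; case: (split_ordP i) => k ->;
by rewrite ?(swap_half_lshift, swap_half_rshift).
Qed.

Lemma label_swap_half i : a (swap_half i) = arc_inv (a i).
Proof.
have [_ _ inv] := a_lab.
case: (split_ordP i) => k ->.
  by rewrite swap_half_lshift inv.
by rewrite swap_half_rshift inv /arc_inv; case: (a _).
Qed.

Lemma matJE i j : matJ a i j = (i == swap_half j)%:R.
Proof.
have [inj _ _] := a_lab.
rewrite mxE -label_swap_half (inj_eq inj) -(inj_eq (inv_inj swap_halfK)).
by rewrite swap_halfK eq_sym; case: eqP.
Qed.

(** Replacing a_j by its inverse turns the condition t(a_i) = o(a_j) into
    equality of termini; the exclusion of backtracking then says that the two
    arcs compared are distinct. *)
Lemma matTE i j :
  matT a i j = fibre_adj int (fun i => terminus (a i)) i (swap_half j).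
Proof.
have [inj _ _] := a_lab.
rewrite !mxE label_swap_half -label_swap_half (inj_eq inj) andbC.
rewrite -(inj_eq (inv_inj swap_halfK)) swap_halfK eq_sym.
by case: andP.
Qed.

Lemma det_matJ : \det (matJ a) = (-1) ^+ m.
Proof.
rewrite -(det_swap_mx int m); congr determinant; apply/matrixP=> i j.
rewrite matJE.
case: (split_ordP i) => k ->; case: (split_ordP j) => l ->;
  rewrite ?(swap_half_lshift, swap_half_rshift)
    ?(block_mxEul, block_mxEur, block_mxEdl, block_mxEdr) !mxE;
  by rewrite ?(inj_eq (@lshift_inj _ _)) ?(inj_eq (@rshift_inj _ _))
       ?eq_lrshift ?eq_rlshift.
Qed.

Lemma reduced_bartholdiE :
  reduced_bartholdi a
    = (-1) ^+ m *: \det (map_mx polyC (fibre_adj int (fun i => terminus (a i)))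
                         + 'X%:M).
Proof.
rewrite /reduced_bartholdi.
set A := fibre_adj _ _.
have -> : map_mx polyC (matT a) + 'X *: map_mx polyC (matJ a)
    = (map_mx polyC A + 'X%:M) *m map_mx polyC (matJ a).
  have hT : forall i j, matT a i j = A i (swap_half j) by apply: matTE.
  (* The matrices are generalized so that mxE does not unfold their definitions. *)
  move: (matT a) (matJ a) A hT matJE => T J A hT hJ.
  apply/matrixP=> i j; rewrite [RHS]mxE (bigD1 (swap_half j)) //=.
  rewrite big1 ?addr0 => [|k nk]; last first.
    by rewrite [X in _ * X]mxE hJ (negPf nk) mulr0.
  rewrite !mxE hT !hJ eqxx mulr1; congr (_ + _).
  by case: eqP; rewrite ?mulr1 ?mulr0.
by rewrite det_mulmx det_map_mx det_matJ mulrC mul_polyC.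
Qed.

(** The arcs ending at v correspond, through their origins, to its neighbours;
    symmetry is needed because the degree counts the arcs leaving v. *)
Lemma card_terminus_fibre (e_sym : symmetric e) v :
  #|[set i | terminus (a i) == v]| = degree e v.
Proof.
have [inj im _] := a_lab.
rewrite -(card_in_imset (f := fun i => origin (a i))) => [|i j]; last first.
  rewrite !inE /origin /terminus => /eqP ti /eqP tj oij; apply: inj.
  by rewrite [a i]surjective_pairing [a j]surjective_pairing ti tj oij.
apply: eq_card => w; rewrite [in RHS]inE e_sym.
apply/imsetP/idP => [[i] | ewv].
  rewrite inE => /eqP <- ->.
  have: a i \in arcs e by rewrite -im imset_f.
  by rewrite inE.
have: (w, v) \in arcs e by rewrite inE.
by rewrite -im => /imsetP[i _ Ei]; exists i; rewrite ?inE -Ei.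
Qed.

End Labelling.

Theorem lemma4p6 (V : finType) (e : rel V)
    (e_sym : symmetric e) (e_irr : irreflexive e)
    (deg_ge2 : forall v : V, (2 <= degree e v)%N)
    (m : nat) (card_edges : #|edges e| = m)
    (a : 'I_(m + m) -> V * V) (a_lab : arc_labelling e a) :
  bartholdi_coef a 3 =
    (-1) ^+ m * (2 * \sum_(v : V | (3 <= degree e v)%N) ('C(degree e v, 3))%:R).
Proof.
rewrite /bartholdi_coef mul2n -addnn; case: ifP => [le3|lt3].
  rewrite (reduced_bartholdiE a_lab) coefZ coef3_det_fibre_adj //.
  congr (_ * (_ * _)); rewrite [RHS]big_mkcond; apply: eq_bigr => v _.
  rewrite (card_terminus_fibre a_lab e_sym).
  by case: ifP => // /negbT; rewrite -ltnNge => /bin_small ->.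
(* With fewer than three arcs both sides vanish: a degree counts arcs, so no
   vertex has degree 3 or more. *)
rewrite big_pred0 ?mulr0 // => v; apply: contraFF lt3 => le3.
apply: leq_trans le3 _; rewrite -(card_terminus_fibre a_lab e_sym).
by rewrite -[X in (_ <= X)%N]card_ord max_card.
Qed.
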